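(* Let $S$ be an (immersed, orientable) minimal surface in $S^3$ with contact angle $\beta$ and characteristic vector field $e_1$. Then the Gaussian curvature $K$ of $S$ is given by $$K=1-|\nabla\beta+e_1|^2,$$ and the contact angle satisfies the Laplacian equation $$\Delta(\beta)=-\tan(\beta)\,|\nabla\beta+2e_1|^2 .$$
   Context: Equip $\mathbb{C}^2$ with the Hermitian product $(z,w)=z^1\bar w^1+z^2\bar w^2$ and the inner product $\langle z,w\rangle=\mathrm{Re}\,(z,w)$, and let $S^3=\{z\in\mathbb{C}^2 : (z,z)=1\}$ be the unit sphere. The Reeb vector field on $S^3$ is $\xi(z)=iz$, and the contact distribution is $\delta_z=\{v\in T_zS^3 : \langle \xi(z),v\rangle=0\}$, which is invariant under multiplication by $i$. Let $S$ be an immersed orientable surface in $S^3$, with the induced metric. The contact angle $\beta$ of $S$ is the complementary angle between the contact distribution $\delta$ and the tangent space $TS$. Concretely, let $(e_1,e_2)$ be a local orthonormal frame of $TS$ with $e_1\in TS\cap\delta$ a unit vector field; $e_1$ is called the characteristic vector field. Then $e_2=\sin(\beta)\,i e_1+\cos(\beta)\,\xi$; in particular $\cos\beta=\langle \xi,e_2\rangle$. $\nabla\beta$ and $\Delta(\beta)=\mathrm{div}\,\nabla\beta$ are the gradient and Laplacian of $\beta$ in the induced metric of $S$. The formulas are understood where such a (smooth) frame exists and $\tan\beta$ is defined, i.e. where $\cos\beta\neq 0$. *)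

(* Defs.v *)
From Stdlib Require Export Reals.
From Coquelicot Require Export Coquelicot.
Open Scope R_scope.

Definition C2 : Type := (C * C)%type.

Definition vadd (z w : C2) : C2 := (Cplus (fst z) (fst w), Cplus (snd z) (snd w)).

(* Real scalars act through the coercion [RtoC]. *)
Definition vscal (a : C) (z : C2) : C2 := (Cmult a (fst z), Cmult a (snd z)).

Definition herm (z w : C2) : C :=
  Cplus (Cmult (fst z) (Cconj (fst w))) (Cmult (snd z) (Cconj (snd w))).

Definition ip (z w : C2) : R := Re (herm z w).

Definition normsq (z : C2) : R := ip z z.

Definition in_S3 (z : C2) : Prop := herm z z = RtoC 1.

Definition tangent_S3 (z v : C2) : Prop := ip z v = 0.

Definition Reeb (z : C2) : C2 := vscal Ci z.

Definition contact_distribution (z v : C2) : Prop :=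
  tangent_S3 z v /\ ip (Reeb z) v = 0.

Inductive idx : Type := I1 | I2.

Definition sum2 (f : idx -> R) : R := f I1 + f I2.

Definition pd (i : idx) (f : R -> R -> R) (u v : R) : R :=
  match i with
  | I1 => Derive (fun s => f s v) u
  | I2 => Derive (fun t => f u t) v
  end.

Definition pdV (i : idx) (F : R -> R -> C2) (u v : R) : C2 :=
  ((pd i (fun s t => Re (fst (F s t))) u v, pd i (fun s t => Im (fst (F s t))) u v),
   (pd i (fun s t => Re (snd (F s t))) u v, pd i (fun s t => Im (snd (F s t))) u v)).

Definition open2 (U : R -> R -> Prop) : Prop :=
  forall u v, U u v -> locally_2d U u v.

(* C^infinity on [U]; only meaningful for open [U], as [ex_diff_n] involves
   the values of [f] near the point. *)
Definition smooth_on (U : R -> R -> Prop) (f : R -> R -> R) : Prop :=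
  forall (n : nat) (u v : R), U u v -> ex_diff_n f n u v.

Definition smoothV_on (U : R -> R -> Prop) (F : R -> R -> C2) : Prop :=
  smooth_on U (fun u v => Re (fst (F u v))) /\
  smooth_on U (fun u v => Im (fst (F u v))) /\
  smooth_on U (fun u v => Re (snd (F u v))) /\
  smooth_on U (fun u v => Im (snd (F u v))).

(** A smooth surface is a set [S] with an atlas [A] of local parametrizations
    defined on open subsets of R^2; the topology of [S] is the one induced by
    the atlas. *)

Record chart (S : Type) : Type := Chart {
  dom : R -> R -> Prop;
  par : R -> R -> S;
  coord : idx -> S -> R  (* inverse of [par]; irrelevant outside [par (dom)] *)
}.
Arguments dom {S}. Arguments par {S}. Arguments coord {S}.

Definition valid_chart {S : Type} (c : chart S) : Prop :=
  open2 (dom c) /\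
  forall u v, dom c u v -> coord c I1 (par c u v) = u /\ coord c I2 (par c u v) = v.

Definition in_chart {S : Type} (c : chart S) (p : S) : Prop :=
  dom c (coord c I1 p) (coord c I2 p) /\ par c (coord c I1 p) (coord c I2 p) = p.

Definition overlap {S : Type} (c d : chart S) (u v : R) : Prop :=
  dom c u v /\ in_chart d (par c u v).

Definition transition {S : Type} (c d : chart S) (k : idx) (u v : R) : R :=
  coord d k (par c u v).

Definition compatible {S : Type} (c d : chart S) : Prop :=
  open2 (overlap c d) /\
  forall k, smooth_on (overlap c d) (transition c d k).

Definition is_atlas {S : Type} (A : chart S -> Prop) : Prop :=
  (forall c, A c -> valid_chart c) /\
  (forall p, exists c, A c /\ in_chart c p) /\
  (forall c d, A c -> A d -> compatible c d).

Definition open_in {S : Type} (A : chart S -> Prop) (W : S -> Prop) : Prop :=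
  forall c, A c -> open2 (fun u v => dom c u v /\ W (par c u v)).

Definition hausdorff {S : Type} (A : chart S -> Prop) : Prop :=
  forall p q : S, p <> q ->
    exists P Q : S -> Prop,
      open_in A P /\ open_in A Q /\ P p /\ Q q /\ forall r, ~ (P r /\ Q r).

(* Each chart domain is second countable, so for the topology of the atlas this
   amounts to [S] being covered by countably many charts. *)
Definition second_countable {S : Type} (A : chart S -> Prop) : Prop :=
  exists f : nat -> chart S, forall p, exists n, A (f n) /\ in_chart (f n) p.

Definition orientable {S : Type} (A : chart S -> Prop) : Prop :=
  exists B : chart S -> Prop,
    is_atlas B /\
    (forall c b, A c -> B b -> compatible c b /\ compatible b c) /\
    (forall b d u v, B b -> B d -> overlap b d u v ->
       0 < pd I1 (transition b d I1) u v * pd I2 (transition b d I2) u v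
           - pd I2 (transition b d I1) u v * pd I1 (transition b d I2) u v).

Definition smooth_fun {S : Type} (A : chart S -> Prop) (W : S -> Prop) (f : S -> R) : Prop :=
  forall c, A c ->
    smooth_on (fun u v => dom c u v /\ W (par c u v)) (fun u v => f (par c u v)).

Definition smooth_field {S : Type} (A : chart S -> Prop) (W : S -> Prop) (Y : S -> C2) : Prop :=
  forall c, A c ->
    smoothV_on (fun u v => dom c u v /\ W (par c u v)) (fun u v => Y (par c u v)).

(** From here to [mean_curvature], [F] is an immersed parametrization, carrying
    the metric induced from C^2. *)

Definition metric (F : R -> R -> C2) (i j : idx) (u v : R) : R :=
  ip (pdV i F u v) (pdV j F u v).

Definition det_metric (F : R -> R -> C2) (u v : R) : R :=
  metric F I1 I1 u v * metric F I2 I2 u v - metric F I1 I2 u v * metric F I2 I1 u v.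

Definition inv_metric (F : R -> R -> C2) (i j : idx) (u v : R) : R :=
  match i, j with
  | I1, I1 => metric F I2 I2 u v / det_metric F u v
  | I1, I2 => - metric F I1 I2 u v / det_metric F u v
  | I2, I1 => - metric F I2 I1 u v / det_metric F u v
  | I2, I2 => metric F I1 I1 u v / det_metric F u v
  end.

(* nabla_{d_i} d_j = sum_k (christoffel k i j) d_k *)
Definition christoffel (F : R -> R -> C2) (k i j : idx) (u v : R) : R :=
  / 2 * sum2 (fun l => inv_metric F k l u v *
    (pd i (metric F j l) u v + pd j (metric F i l) u v - pd l (metric F i j) u v)).

(* R(d_k, d_l) d_j = sum_i (riemann i j k l) d_i,
   with R(X,Y) = [nabla_X, nabla_Y] - nabla_[X,Y] *)
Definition riemann (F : R -> R -> C2) (i j k l : idx) (u v : R) : R :=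
  pd k (christoffel F i l j) u v - pd l (christoffel F i k j) u v
  + sum2 (fun m => christoffel F i k m u v * christoffel F m l j u v
                   - christoffel F i l m u v * christoffel F m k j u v).

(* <R(d_1, d_2) d_2, d_1> / (|d_1|^2 |d_2|^2 - <d_1, d_2>^2) *)
Definition gauss_curvature (F : R -> R -> C2) (u v : R) : R :=
  sum2 (fun i => metric F i I1 u v * riemann F i I2 I1 I2 u v) / det_metric F u v.

(* Coordinates of the gradient in the basis d_1, d_2 *)
Definition grad_coord (F : R -> R -> C2) (f : R -> R -> R) (i : idx) (u v : R) : R :=
  sum2 (fun j => inv_metric F i j u v * pd j f u v).

(* Tangent vectors of the surface are identified with their images under dF. *)
Definition gradient (F : R -> R -> C2) (f : R -> R -> R) (u v : R) : C2 :=
  vadd (vscal (grad_coord F f I1 u v) (pdV I1 F u v))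
       (vscal (grad_coord F f I2 u v) (pdV I2 F u v)).

(* Trace of the covariant derivative of Y = Y^1 d_1 + Y^2 d_2 *)
Definition divergence (F : R -> R -> C2) (Y : idx -> R -> R -> R) (u v : R) : R :=
  sum2 (fun i => pd i (Y i) u v + sum2 (fun k => christoffel F i i k u v * Y k u v)).

Definition laplacian (F : R -> R -> C2) (f : R -> R -> R) (u v : R) : R :=
  divergence F (grad_coord F f) u v.

Definition tangent_param (F : R -> R -> C2) (u v : R) (w : C2) : Prop :=
  exists a b : R, w = vadd (vscal a (pdV I1 F u v)) (vscal b (pdV I2 F u v)).

Definition unit_normal_param (F : R -> R -> C2) (u v : R) (N : C2) : Prop :=
  tangent_S3 (F u v) N /\ normsq N = 1 /\ forall i, ip (pdV i F u v) N = 0.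

(* Second fundamental form of the surface in S^3 along [N].  The covariant
   derivative of S^3 is the tangential part of the derivative of C^2, and
   [N] is tangent to S^3, so the latter may be used. *)
Definition second_form (F : R -> R -> C2) (N : C2) (i j : idx) (u v : R) : R :=
  ip (pdV i (pdV j F) u v) N.

Definition mean_curvature (F : R -> R -> C2) (N : C2) (u v : R) : R :=
  / 2 * sum2 (fun i => sum2 (fun j => inv_metric F i j u v * second_form F N i j u v)).

Definition at_point {S T : Type} (c : chart S) (p : S) (Q : R -> R -> T) : T :=
  Q (coord c I1 p) (coord c I2 p).

Definition in_coords {S T : Type} (c : chart S) (f : S -> T) (u v : R) : T :=
  f (par c u v).

Record immersed_orientable_surface {S : Type} (A : chart S -> Prop) (X : S -> C2) : Prop := {
  ios_atlas : is_atlas A;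
  ios_hausdorff : hausdorff A;
  ios_second_countable : second_countable A;
  ios_orientable : orientable A;
  ios_sphere : forall p, in_S3 (X p);
  ios_smooth : smooth_field A (fun _ => True) X;
  ios_immersion : forall c p, A c -> in_chart c p ->
    forall a b : R,
      vadd (vscal a (at_point c p (pdV I1 (in_coords c X))))
           (vscal b (at_point c p (pdV I2 (in_coords c X)))) = (RtoC 0, RtoC 0) ->
      a = 0 /\ b = 0
}.

Definition minimal {S : Type} (A : chart S -> Prop) (X : S -> C2) : Prop :=
  forall c p (N : C2), A c -> in_chart c p ->
    at_point c p (fun u v => unit_normal_param (in_coords c X) u v N) ->
    at_point c p (mean_curvature (in_coords c X) N) = 0.

(* [w] belongs to T_p S, identified with its image in C^2 under dX *)
Definition tangent {S : Type} (A : chart S -> Prop) (X : S -> C2) (p : S) (w : C2) : Prop :=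
  forall c, A c -> in_chart c p ->
    at_point c p (fun u v => tangent_param (in_coords c X) u v w).

(* On the open set [W], [e1] is a characteristic vector field, [(e1, e2)] the
   adapted orthonormal frame and [beta] the contact angle. *)
Record contact_angle_frame {S : Type} (A : chart S -> Prop) (X : S -> C2) (W : S -> Prop)
    (e1 e2 : S -> C2) (beta : S -> R) : Prop := {
  caf_open : open_in A W;
  caf_smooth_e1 : smooth_field A W e1;
  caf_smooth_e2 : smooth_field A W e2;
  caf_smooth_beta : smooth_fun A W beta;
  caf_tangent_e1 : forall p, W p -> tangent A X p (e1 p);
  caf_tangent_e2 : forall p, W p -> tangent A X p (e2 p);
  caf_contact_e1 : forall p, W p -> contact_distribution (X p) (e1 p);
  caf_unit_e1 : forall p, W p -> normsq (e1 p) = 1;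
  caf_unit_e2 : forall p, W p -> normsq (e2 p) = 1;
  caf_orthogonal : forall p, W p -> ip (e1 p) (e2 p) = 0;
  caf_angle : forall p, W p ->
    e2 p = vadd (vscal (sin (beta p)) (vscal Ci (e1 p)))
                (vscal (cos (beta p)) (Reeb (X p)))
}.

(* These do not depend on the chart [c] around [p]. *)

Definition K_at {S : Type} (X : S -> C2) (c : chart S) (p : S) : R :=
  at_point c p (gauss_curvature (in_coords c X)).

Definition grad_at {S : Type} (X : S -> C2) (f : S -> R) (c : chart S) (p : S) : C2 :=
  at_point c p (gradient (in_coords c X) (in_coords c f)).

Definition Laplacian_at {S : Type} (X : S -> C2) (f : S -> R) (c : chart S) (p : S) : R :=
  at_point c p (laplacian (in_coords c X) (in_coords c f)).

(* Main.v *)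
From Stdlib Require Import Reals Lra.
Require Import Defs.

(** With [N = cos(beta) i e1 - sin(beta) xi], the vectors [x, e1, e2, N] form an
    orthonormal basis of C^2 at each point [x] of the surface.  Let [h] be the
    second fundamental form, [omega(v) = <D_v e1, e2>], and let [a], [b] be the
    coframe dual to [e1], [e2].
    Differentiating [e2 = sin(beta) i e1 + cos(beta) xi] and taking components
    gives [d beta = h(., e2) - a] and [cos(beta) omega = sin(beta) (h(., e1) + b)].
    Hence [grad beta + e1] is the vector dual to [h(., e2)]; by minimality its
    squared norm is [h12^2 + h22^2 = - det h], and the Gauss equation yields [K].
    Minimality also gives [* d beta = h(., e1) - b], whose exterior derivative is,
    by the Codazzi and structure equations, [omega /\ (h(., e2) + a)].
    Substituting [omega] gives the Laplacian. *)

(** * Calculus of partial derivatives *)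

(** Relational form of [pd]: it also records that the derivative exists, which the total function
    [Derive] does not. *)
Definition is_pd (i : idx) (f : R -> R -> R) (u v l : R) : Prop :=
  match i with
  | I1 => is_derive (fun s => f s v) u l
  | I2 => is_derive (fun t => f u t) v l
  end.

Lemma is_pd_unique i f u v l : is_pd i f u v l -> pd i f u v = l.
Proof. destruct i; apply is_derive_unique. Qed.

Lemma is_pd_eq i f u v l l' : is_pd i f u v l -> l = l' -> is_pd i f u v l'.
Proof. intros H <-. exact H. Qed.

Lemma is_pd_ext_on U i f g u v l :
  open2 U -> (forall s t, U s t -> f s t = g s t) -> U u v ->
  is_pd i g u v l -> is_pd i f u v l.
Proof.
intros HU Hfg Huv. destruct (HU u v Huv) as [d Hd].
assert (H0 : forall x, Rabs (x - x) < d).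
{ intros x. rewrite Rminus_diag, Rabs_R0. apply cond_pos. }
destruct i; apply is_derive_ext_loc; exists d; intros z Hz; symmetry; apply Hfg, Hd;
  solve [apply H0 | exact Hz].
Qed.

Lemma is_pd_ext i f g u v l :
  (forall s t, f s t = g s t) -> is_pd i g u v l -> is_pd i f u v l.
Proof.
intros H; destruct i; apply is_derive_ext; intros; symmetry; apply H.
Qed.

Lemma is_pd_const i k u v : is_pd i (fun _ _ => k) u v 0.
Proof. destruct i; exact (is_derive_const k _). Qed.

Lemma is_pd_plus i f g u v l m :
  is_pd i f u v l -> is_pd i g u v m -> is_pd i (fun s t => f s t + g s t) u v (l + m).
Proof.
destruct i; intros Hf Hg;
  [ exact (is_derive_plus (fun s => f s v) (fun s => g s v) u l m Hf Hg)
  | exact (is_derive_plus (fun t => f u t) (fun t => g u t) v l m Hf Hg) ].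
Qed.

Lemma is_pd_opp i f u v l : is_pd i f u v l -> is_pd i (fun s t => - f s t) u v (- l).
Proof.
destruct i; intros Hf;
  [ exact (is_derive_opp (fun s => f s v) u l Hf)
  | exact (is_derive_opp (fun t => f u t) v l Hf) ].
Qed.

Lemma is_pd_minus i f g u v l m :
  is_pd i f u v l -> is_pd i g u v m -> is_pd i (fun s t => f s t - g s t) u v (l - m).
Proof. intros Hf Hg. exact (is_pd_plus _ _ _ _ _ _ _ Hf (is_pd_opp _ _ _ _ _ Hg)). Qed.

Lemma is_pd_mult i f g u v l m :
  is_pd i f u v l -> is_pd i g u v m ->
  is_pd i (fun s t => f s t * g s t) u v (l * g u v + f u v * m).
Proof.
destruct i; intros Hf Hg;
  [ exact (is_derive_mult (fun s => f s v) (fun s => g s v) u l m Hf Hg Rmult_comm)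
  | exact (is_derive_mult (fun t => f u t) (fun t => g u t) v l m Hf Hg Rmult_comm) ].
Qed.

Lemma is_pd_div i f g u v l m :
  is_pd i f u v l -> is_pd i g u v m -> g u v <> 0 ->
  is_pd i (fun s t => f s t / g s t) u v ((l * g u v - f u v * m) / (g u v) ^ 2).
Proof.
destruct i; intros Hf Hg H0;
  [ exact (is_derive_div (fun s => f s v) (fun s => g s v) u l m Hf Hg H0)
  | exact (is_derive_div (fun t => f u t) (fun t => g u t) v l m Hf Hg H0) ].
Qed.

Lemma is_pd_comp i (h : R -> R) f u v l m :
  is_derive h (f u v) m -> is_pd i f u v l -> is_pd i (fun s t => h (f s t)) u v (l * m).
Proof.
destruct i; intros Hh Hf;
  [ exact (is_derive_comp h (fun s => f s v) u m l Hh Hf)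
  | exact (is_derive_comp h (fun t => f u t) v m l Hh Hf) ].
Qed.

Lemma is_pd_sin i f u v l :
  is_pd i f u v l -> is_pd i (fun s t => sin (f s t)) u v (l * cos (f u v)).
Proof. apply is_pd_comp, is_derive_Reals, derivable_pt_lim_sin. Qed.

Lemma is_pd_cos i f u v l :
  is_pd i f u v l -> is_pd i (fun s t => cos (f s t)) u v (l * - sin (f u v)).
Proof. apply is_pd_comp, is_derive_Reals, derivable_pt_lim_cos. Qed.

(** * Derivatives of maps into C^2 *)

Definition is_pdV (i : idx) (F : R -> R -> C2) (u v : R) (V : C2) : Prop :=
  is_pd i (fun s t => Re (fst (F s t))) u v (Re (fst V)) /\
  is_pd i (fun s t => Im (fst (F s t))) u v (Im (fst V)) /\
  is_pd i (fun s t => Re (snd (F s t))) u v (Re (snd V)) /\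
  is_pd i (fun s t => Im (snd (F s t))) u v (Im (snd V)).

Lemma ip_re z w :
  ip z w = Re (fst z) * Re (fst w) + Im (fst z) * Im (fst w)
         + (Re (snd z) * Re (snd w) + Im (snd z) * Im (snd w)).
Proof. unfold ip, herm, Re, Im. simpl. ring. Qed.

Lemma C2_eq (z w : C2) :
  Re (fst z) = Re (fst w) -> Im (fst z) = Im (fst w) ->
  Re (snd z) = Re (snd w) -> Im (snd z) = Im (snd w) -> z = w.
Proof.
destruct z as [[a b] [c d]], w as [[a' b'] [c' d']]; simpl. now intros -> -> -> ->.
Qed.

Lemma is_pdV_unique i F u v V : is_pdV i F u v V -> pdV i F u v = V.
Proof.
intros (H1 & H2 & H3 & H4).
apply C2_eq; simpl; now apply is_pd_unique.
Qed.

Lemma is_pd_ip i F G u v V W :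
  is_pdV i F u v V -> is_pdV i G u v W ->
  is_pd i (fun s t => ip (F s t) (G s t)) u v (ip V (G u v) + ip (F u v) W).
Proof.
intros (F1 & F2 & F3 & F4) (G1 & G2 & G3 & G4).
eapply is_pd_ext; [intros s t; apply ip_re | eapply is_pd_eq].
- exact (is_pd_plus _ _ _ _ _ _ _
  (is_pd_plus _ _ _ _ _ _ _ (is_pd_mult _ _ _ _ _ _ _ F1 G1) (is_pd_mult _ _ _ _ _ _ _ F2 G2))
  (is_pd_plus _ _ _ _ _ _ _ (is_pd_mult _ _ _ _ _ _ _ F3 G3) (is_pd_mult _ _ _ _ _ _ _ F4 G4))).
- rewrite !ip_re. ring.
Qed.

Lemma is_pdV_vadd i F G u v V W :
  is_pdV i F u v V -> is_pdV i G u v W ->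
  is_pdV i (fun s t => vadd (F s t) (G s t)) u v (vadd V W).
Proof.
intros (F1 & F2 & F3 & F4) (G1 & G2 & G3 & G4).
repeat split; now apply is_pd_plus.
Qed.

Lemma vscal_re (r : R) z :
  vscal r z = ((r * Re (fst z), r * Im (fst z)), (r * Re (snd z), r * Im (snd z))).
Proof. apply C2_eq; unfold vscal, Cmult, RtoC, Ci, Re, Im; simpl; ring. Qed.

Lemma vscal_Ci z :
  vscal Ci z = ((- Im (fst z), Re (fst z)), (- Im (snd z), Re (snd z))).
Proof. apply C2_eq; unfold vscal, Cmult, RtoC, Ci, Re, Im; simpl; ring. Qed.

Lemma is_pdV_Ci i F u v V :
  is_pdV i F u v V -> is_pdV i (fun s t => vscal Ci (F s t)) u v (vscal Ci V).
Proof.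
intros (F1 & F2 & F3 & F4).
rewrite vscal_Ci.
repeat split; (eapply is_pd_ext; [intros s t; rewrite vscal_Ci; reflexivity | ]); simpl;
  now try apply is_pd_opp.
Qed.

Lemma is_pdV_vscal i (f : R -> R -> R) F u v l V :
  is_pd i f u v l -> is_pdV i F u v V ->
  is_pdV i (fun s t => vscal (f s t) (F s t)) u v (vadd (vscal l (F u v)) (vscal (f u v) V)).
Proof.
intros Hf (F1 & F2 & F3 & F4).
rewrite !vscal_re.
repeat split; (eapply is_pd_ext; [intros s t; rewrite vscal_re; reflexivity | ]); simpl;
  now apply is_pd_mult.
Qed.

(** * Smoothness and symmetry of second derivatives *)

Lemma smooth_on_pd U i f : smooth_on U f -> smooth_on U (pd i f).
Proof.
intros H n u v Huv. destruct i; apply (H (S n) u v Huv).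
Qed.

Lemma smoothV_on_pdV U i F : smoothV_on U F -> smoothV_on U (pdV i F).
Proof.
intros (H1 & H2 & H3 & H4).
repeat split; [apply (smooth_on_pd U i _ H1) | apply (smooth_on_pd U i _ H2)
  | apply (smooth_on_pd U i _ H3) | apply (smooth_on_pd U i _ H4)].
Qed.

Lemma smooth_is_pd U i f u v : smooth_on U f -> U u v -> is_pd i f u v (pd i f u v).
Proof.
intros H Huv. destruct i; apply Derive_correct; apply (H 1%nat u v Huv).
Qed.

Lemma smooth_is_pdV U i F u v : smoothV_on U F -> U u v -> is_pdV i F u v (pdV i F u v).
Proof.
intros (H1 & H2 & H3 & H4) Huv.
repeat split; eapply smooth_is_pd; eassumption.
Qed.

Lemma pd_comm U i j f u v :
  open2 U -> smooth_on U f -> U u v -> pd i (pd j f) u v = pd j (pd i f) u v.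
Proof.
intros HU H Huv.
assert (H12 : pd I1 (pd I2 f) u v = pd I2 (pd I1 f) u v).
{ apply Schwarz.
  (* Smoothness of order 2 on the open set gives the derivatives required by Schwarz near the point,
     and continuity of the mixed ones at it. *)
  - apply locally_2d_impl with (2 := HU u v Huv), locally_2d_forall.
    intros s t Hst. destruct (H 2%nat s t Hst) as (_ & Ha & Hb & Hc & Hd).
    repeat split; [exact Ha | exact Hb | apply Hd | apply Hc].
  - apply (H 2%nat u v Huv).
  - apply (H 2%nat u v Huv). }
destruct i, j; congruence.
Qed.

Lemma pdV_comm U i j F u v :
  open2 U -> smoothV_on U F -> U u v -> pdV i (pdV j F) u v = pdV j (pdV i F) u v.
Proof.
intros HU (H1 & H2 & H3 & H4) Huv.
apply C2_eq; simpl; eapply pd_comm; eassumption.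
Qed.

(** * Algebra of the inner product and of multiplication by i *)

Lemma ip_sym z w : ip z w = ip w z.
Proof. rewrite !ip_re. ring. Qed.

Lemma ip_vadd_l x y z : ip (vadd x y) z = ip x z + ip y z.
Proof. rewrite !ip_re. unfold Re, Im. simpl. ring. Qed.

Lemma ip_vscal_l (r : R) x z : ip (vscal r x) z = r * ip x z.
Proof. rewrite vscal_re, !ip_re. unfold Re, Im. simpl. ring. Qed.

Lemma ip_vadd_r x y z : ip z (vadd x y) = ip z x + ip z y.
Proof. now rewrite ip_sym, ip_vadd_l, !(ip_sym z). Qed.

Lemma ip_vscal_r (r : R) x z : ip z (vscal r x) = r * ip z x.
Proof. now rewrite ip_sym, ip_vscal_l, (ip_sym z). Qed.

Lemma ip_Ci_Ci x y : ip (vscal Ci x) (vscal Ci y) = ip x y.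
Proof. rewrite !vscal_Ci, !ip_re. unfold Re, Im. simpl. ring. Qed.

Lemma ip_Ci_l x y : ip (vscal Ci x) y = - ip x (vscal Ci y).
Proof. rewrite !vscal_Ci, !ip_re. unfold Re, Im. simpl. ring. Qed.

Lemma ip_Ci_diag x : ip x (vscal Ci x) = 0.
Proof. rewrite !vscal_Ci, !ip_re. unfold Re, Im. simpl. ring. Qed.

Lemma is_pd_pd i f u v l : is_pd i f u v l -> is_pd i f u v (pd i f u v).
Proof. intros H. now rewrite (is_pd_unique _ _ _ _ _ H). Qed.

(** * Intrinsic geometry of a parametrized surface in C^2 *)

Section Metric.

Context (U : R -> R -> Prop) (F : R -> R -> C2).
Hypothesis HU : open2 U.
Hypothesis HF : smoothV_on U F.

Lemma metric_sym i j u v : metric F i j u v = metric F j i u v.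
Proof. apply ip_sym. Qed.

Lemma is_pd_metric k i j u v : U u v ->
  is_pd k (metric F i j) u v
    (ip (pdV k (pdV i F) u v) (pdV j F u v) + ip (pdV k (pdV j F) u v) (pdV i F u v)).
Proof.
intros Huv. rewrite (ip_sym (pdV k (pdV j F) u v)).
apply is_pd_ip; eapply smooth_is_pdV; eauto using smoothV_on_pdV.
Qed.

(** The product-rule formula for the first derivative holds throughout the open set [U], so it may
    be differentiated again. *)
Lemma is_pd_pd_metric k l i j u v : U u v ->
  is_pd k (pd l (metric F i j)) u v (pd k (pd l (metric F i j)) u v).
Proof.
intros Huv. eapply is_pd_pd, is_pd_ext_on; [exact HU | | exact Huv | ].
- intros s t Hst. apply is_pd_unique, is_pd_metric, Hst.
- apply is_pd_plus; apply is_pd_ip; eapply smooth_is_pdV; eauto using smoothV_on_pdV.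
Qed.

Lemma is_pd_det_metric k u v : U u v ->
  is_pd k (det_metric F) u v
    (pd k (metric F I1 I1) u v * metric F I2 I2 u v
     + metric F I1 I1 u v * pd k (metric F I2 I2) u v
     - 2 * metric F I1 I2 u v * pd k (metric F I1 I2) u v).
Proof.
intros Huv.
assert (Hm := fun i j => is_pd_pd _ _ _ _ _ (is_pd_metric k i j u v Huv)).
eapply is_pd_eq.
- apply is_pd_minus; apply is_pd_mult; apply Hm.
- rewrite (is_pd_unique _ _ _ _ _ (is_pd_metric k I2 I1 u v Huv)).
  rewrite (is_pd_unique _ _ _ _ _ (is_pd_metric k I1 I2 u v Huv)).
  rewrite (metric_sym I2 I1).
  ring.
Qed.

Lemma is_pd_inv_metric k i j u v : U u v -> det_metric F u v <> 0 ->
  is_pd k (inv_metric F i j) u v (pd k (inv_metric F i j) u v).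
Proof.
intros Huv Hdet.
assert (Hm := fun i j => is_pd_metric k i j u v Huv).
assert (Hd := is_pd_det_metric k u v Huv).
assert (Hdiv := fun f l (H : is_pd k f u v l) =>
  is_pd_pd _ _ _ _ _ (is_pd_div _ _ _ _ _ _ _ H Hd Hdet)).
destruct i, j;
  [ exact (Hdiv _ _ (Hm I2 I2))
  | exact (Hdiv _ _ (is_pd_opp _ _ _ _ _ (Hm I1 I2)))
  | exact (Hdiv _ _ (is_pd_opp _ _ _ _ _ (Hm I2 I1)))
  | exact (Hdiv _ _ (Hm I1 I1)) ].
Qed.

Lemma is_pd_christoffel n k i j u v : U u v -> det_metric F u v <> 0 ->
  is_pd n (christoffel F k i j) u v (pd n (christoffel F k i j) u v).
Proof.
intros Huv Hdet.
eapply is_pd_pd, is_pd_mult; [apply is_pd_const | ].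
apply is_pd_plus; (apply is_pd_mult; [now apply is_pd_inv_metric | ]);
  (apply is_pd_minus; [apply is_pd_plus | ]; now apply is_pd_pd_metric).
Qed.

(** Koszul's formula: once second derivatives commute, the three metric derivatives add up to twice
    the right-hand side. The Christoffel symbols are thus the coordinates of the tangential part of
    the second derivatives of [F]. *)
Lemma christoffel_lower i j l u v : U u v -> det_metric F u v <> 0 ->
  sum2 (fun k => christoffel F k i j u v * metric F k l u v)
  = ip (pdV i (pdV j F) u v) (pdV l F u v).
Proof.
intros Huv Hdet.
assert (Hm := fun k i j => is_pd_unique _ _ _ _ _ (is_pd_metric k i j u v Huv)).
unfold christoffel, sum2. rewrite !Hm.
unfold inv_metric. revert Hdet. unfold det_metric. rewrite (metric_sym I2 I1). intros Hdet.
destruct i, j, l; rewrite ?(pdV_comm U I2 I1 F) by assumption;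
  rewrite ?(metric_sym I2 I1); field; exact Hdet.
Qed.

(** Jacobi's formula for the derivative of a determinant, applied to the metric. *)
Lemma christoffel_trace k u v : U u v -> det_metric F u v <> 0 ->
  sum2 (fun i => christoffel F i i k u v) = pd k (det_metric F) u v / (2 * det_metric F u v).
Proof.
intros Huv Hdet.
rewrite (is_pd_unique _ _ _ _ _ (is_pd_det_metric k u v Huv)).
assert (Hm := fun k i j => is_pd_unique _ _ _ _ _ (is_pd_metric k i j u v Huv)).
unfold christoffel, sum2. rewrite !Hm.
unfold inv_metric. revert Hdet. unfold det_metric. rewrite (metric_sym I2 I1). intros Hdet.
destruct k; rewrite ?(pdV_comm U I2 I1 F) by assumption; field; exact Hdet.
Qed.

(** Gauss equation for a surface in flat C^2. Two instances of [christoffel_lower] are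
    differentiated and subtracted, so that the third derivatives of [F] cancel. *)
Lemma gauss_equation u v : U u v -> (forall s t, U s t -> det_metric F s t <> 0) ->
  sum2 (fun i => metric F i I1 u v * riemann F i I2 I1 I2 u v)
  = ip (pdV I2 (pdV I2 F) u v) (pdV I1 (pdV I1 F) u v)
    - ip (pdV I1 (pdV I2 F) u v) (pdV I1 (pdV I2 F) u v)
    - sum2 (fun i => christoffel F i I2 I2 u v * ip (pdV i F u v) (pdV I1 (pdV I1 F) u v))
    + sum2 (fun i => christoffel F i I1 I2 u v * ip (pdV i F u v) (pdV I1 (pdV I2 F) u v)).
Proof.
intros Huv Hdet.
(* [Hd] differentiates the right side of [christoffel_lower], and [He] below its left side. *)
assert (Hd := fun n i j =>
  is_pd_ext_on U n _ _ u v _ HU (fun s t Hst => christoffel_lower i j I1 s t Hst (Hdet s t Hst)) Huv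
    (is_pd_ip n _ _ u v _ _
      (smooth_is_pdV U n _ u v (smoothV_on_pdV _ _ _ (smoothV_on_pdV _ j _ HF)) Huv)
      (smooth_is_pdV U n _ u v (smoothV_on_pdV _ I1 _ HF) Huv))).
assert (He : forall n i j, is_pd n (fun s t => sum2 (fun k => christoffel F k i j s t * metric F k I1 s t))
   u v (sum2 (fun k => pd n (christoffel F k i j) u v * metric F k I1 u v
      + christoffel F k i j u v * pd n (metric F k I1) u v))).
{ intros n i j. apply is_pd_plus; (apply is_pd_mult; [now apply is_pd_christoffel; auto | ]);
  eapply is_pd_pd; now apply is_pd_metric. }
assert (E1 := eq_trans (eq_sym (is_pd_unique _ _ _ _ _ (He I1 I2 I2))) (is_pd_unique _ _ _ _ _ (Hd I1 I2 I2))).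
assert (E2 := eq_trans (eq_sym (is_pd_unique _ _ _ _ _ (He I2 I1 I2))) (is_pd_unique _ _ _ _ _ (Hd I2 I1 I2))).
assert (L := fun i j => christoffel_lower i j I1 u v Huv (Hdet u v Huv)).
assert (Hm := fun k i j => is_pd_unique _ _ _ _ _ (is_pd_metric k i j u v Huv)).
unfold sum2 in *. rewrite !Hm in E1, E2.
assert (E3 : pdV I1 (pdV I2 (pdV I2 F)) u v = pdV I2 (pdV I1 (pdV I2 F)) u v)
  by (apply (pdV_comm U); auto using smoothV_on_pdV).
rewrite E3 in E1.
(* The terms of [riemann] quadratic in the Christoffel symbols become linear after one factor is
   lowered with the metric. *)
assert (M := fun r i j => f_equal (Rmult r) (L i j)).
assert (M11 := M (christoffel F I1 I2 I2 u v) I1 I1).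
assert (M12 := M (christoffel F I2 I2 I2 u v) I1 I2).
assert (M21 := M (christoffel F I1 I1 I2 u v) I2 I1).
assert (M22 := M (christoffel F I2 I1 I2 u v) I2 I2).
assert (E4 : pdV I2 (pdV I1 F) u v = pdV I1 (pdV I2 F) u v) by now apply (pdV_comm U).
rewrite E4 in E2, M21.
unfold riemann, sum2.
rewrite !(ip_sym (pdV I1 F u v)), !(ip_sym (pdV I2 F u v)).
rewrite (ip_sym (pdV I2 (pdV I2 F) u v)) in E1 |- *.
clear - E1 E2 M11 M12 M21 M22. lra.
Qed.

End Metric.

(** The identity div Y = (1/D) sum_i d_i (D Y^i) with D^2 = det g: the trace of the Christoffel
    symbols is the logarithmic derivative of [D]. The sign of [D] is free, so a signed area is
    allowed. *)
Lemma divergence_density U F (Y Z : idx -> R -> R -> R) (D : R -> R -> R) u v d1 d2 z1 z2 :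
  open2 U -> smoothV_on U F -> U u v ->
  (forall s t, U s t -> det_metric F s t = D s t ^ 2) ->
  (forall i s t, U s t -> Y i s t = Z i s t / D s t) ->
  D u v <> 0 ->
  is_pd I1 D u v d1 -> is_pd I2 D u v d2 ->
  is_pd I1 (Z I1) u v z1 -> is_pd I2 (Z I2) u v z2 ->
  divergence F Y u v = (z1 + z2) / D u v.
Proof.
intros HU HF Huv HD HY HD0 Hd1 Hd2 Hz1 Hz2.
assert (Hdet : det_metric F u v <> 0) by (rewrite HD by exact Huv; now apply pow_nonzero).
assert (Ht := fun k => christoffel_trace U F HU HF k u v Huv Hdet).
assert (Hpd : forall k d, is_pd k D u v d -> pd k (det_metric F) u v = 2 * D u v * d).
{ intros k d Hd. apply is_pd_unique.
  apply (is_pd_ext_on U _ _ (fun s t => D s t * D s t)); [exact HU | | exact Huv | ].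
  - intros s t Hst. rewrite HD by exact Hst. ring.
  - eapply is_pd_eq; [exact (is_pd_mult _ _ _ _ _ _ _ Hd Hd) | ring]. }
assert (T1 := Ht I1). assert (T2 := Ht I2). unfold sum2 in T1, T2.
rewrite (Hpd _ _ Hd1), HD in T1 by exact Huv. rewrite (Hpd _ _ Hd2), HD in T2 by exact Huv.
unfold divergence, sum2.
assert (HYd : forall k z d, is_pd k (Z k) u v z -> is_pd k D u v d ->
  pd k (Y k) u v = (z * D u v - Z k u v * d) / D u v ^ 2).
{ intros k z d Hz Hd. apply is_pd_unique.
  eapply is_pd_ext_on; [exact HU | exact (HY k) | exact Huv | now apply is_pd_div]. }
rewrite (HYd I1 _ _ Hz1 Hd1), (HYd I2 _ _ Hz2 Hd2), !HY by exact Huv.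
transitivity ((z1 * D u v - Z I1 u v * d1) / D u v ^ 2 + (z2 * D u v - Z I2 u v * d2) / D u v ^ 2
  + (christoffel F I1 I1 I1 u v + christoffel F I2 I2 I1 u v) * (Z I1 u v / D u v)
  + (christoffel F I1 I1 I2 u v + christoffel F I2 I2 I2 u v) * (Z I2 u v / D u v)).
- ring.
- rewrite T1, T2. field. exact HD0.
Qed.

(* [(x, e)] is a unitary basis of C^2: if [x = (z, w)] then [e] is a unit complex
   multiple of [(- conj w, conj z)]. *)
Lemma parseval_contact x e v w :
  in_S3 x -> contact_distribution x e -> normsq e = 1 ->
  ip v w = ip v x * ip w x + ip v e * ip w e
           + (ip v (vscal Ci x) * ip w (vscal Ci x) + ip v (vscal Ci e) * ip w (vscal Ci e)).
Proof.
intros Hx [Ht Hc] He.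
assert (Hx' : ip x x = 1) by (unfold ip; now rewrite Hx).
unfold tangent_S3 in Ht. unfold Reeb in Hc. unfold normsq in He.
rewrite !vscal_Ci in *. rewrite !ip_re in *. clear Hx.
destruct x as [[z1 z2] [w1 w2]], e as [[p1 p2] [q1 q2]], v as [[a1 a2] [a3 a4]], w as [[b1 b2] [b3 b4]].
unfold Re, Im in *. simpl in *.
(* With x = (z, w) and e = (p, q), [l1] + i [l2] is the complex determinant zq - wp, which is the
   multiplier of (- conj w, conj z) giving e. *)
set (l1 := q1 * z1 - q2 * z2 - p1 * w1 + p2 * w2).
set (l2 := q1 * z2 + q2 * z1 - p1 * w2 - p2 * w1).
assert (E1 : p1 = - (l1 * w1 + l2 * w2)).
{ unfold l1, l2. apply (f_equal (Rmult p1)) in Hx'.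
  assert (H1 := f_equal (Rmult z1) Ht). assert (H2 := f_equal (Rmult z2) Hc). clear -Hx' H1 H2. lra. }
assert (E2 : p2 = l1 * w2 - l2 * w1).
{ unfold l1, l2. apply (f_equal (Rmult p2)) in Hx'.
  assert (H1 := f_equal (Rmult z2) Ht). assert (H2 := f_equal (Rmult z1) Hc). clear -Hx' H1 H2. lra. }
assert (E3 : q1 = l1 * z1 + l2 * z2).
{ unfold l1, l2. apply (f_equal (Rmult q1)) in Hx'.
  assert (H1 := f_equal (Rmult w1) Ht). assert (H2 := f_equal (Rmult w2) Hc). clear -Hx' H1 H2. lra. }
assert (E4 : q2 = l2 * z1 - l1 * z2).
{ unfold l1, l2. apply (f_equal (Rmult q2)) in Hx'.
  assert (H1 := f_equal (Rmult w2) Ht). assert (H2 := f_equal (Rmult w1) Hc). clear -Hx' H1 H2. lra. }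
clearbody l1 l2. subst p1 p2 q1 q2.
assert (HL : l1 * l1 + l2 * l2 = 1).
{ transitivity ((l1 * l1 + l2 * l2) * (z1 * z1 + z2 * z2 + (w1 * w1 + w2 * w2))).
  - rewrite Hx'. ring.
  - rewrite <- He. ring. }
transitivity ((z1 * z1 + z2 * z2 + (w1 * w1 + w2 * w2)) * (a1 * b1 + a2 * b2 + (a3 * b3 + a4 * b4))).
- rewrite Hx'. ring.
(* [B] is the joint contribution of e0 = (- conj w, conj z) and i e0; that of e and i e is [B] times
   the squared modulus of the multiplier, which is 1. *)
- set (B := (a1 * - w1 + a2 * w2 + (a3 * z1 - a4 * z2)) * (b1 * - w1 + b2 * w2 + (b3 * z1 - b4 * z2))
   + (a1 * w2 + a2 * w1 - (a3 * z2 + a4 * z1)) * (b1 * w2 + b2 * w1 - (b3 * z2 + b4 * z1))).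
  transitivity ((z1 * z1 + z2 * z2 + (w1 * w1 + w2 * w2)) * (a1 * b1 + a2 * b2 + (a3 * b3 + a4 * b4))
     + (l1 * l1 + l2 * l2 - 1) * B).
  + rewrite HL. ring.
  + unfold B. ring.
Qed.

(** * The adapted frame along a minimal surface in S^3 *)

Section AdaptedFrame.

Context (U : R -> R -> Prop) (F e1 e2 : R -> R -> C2) (beta : R -> R -> R).
Hypothesis HU : open2 U.
Hypothesis HF : smoothV_on U F.
Hypothesis He1 : smoothV_on U e1.
Hypothesis He2 : smoothV_on U e2.
Hypothesis Hbeta : smooth_on U beta.
Hypothesis sphere : forall s t, U s t -> in_S3 (F s t).
Hypothesis contact : forall s t, U s t -> contact_distribution (F s t) (e1 s t).
Hypothesis unit_e1 : forall s t, U s t -> normsq (e1 s t) = 1.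
Hypothesis tangent_e1 : forall s t, U s t -> tangent_param F s t (e1 s t).
Hypothesis tangent_e2 : forall s t, U s t -> tangent_param F s t (e2 s t).
Hypothesis angle : forall s t, U s t ->
  e2 s t = vadd (vscal (sin (beta s t)) (vscal Ci (e1 s t)))
                (vscal (cos (beta s t)) (Reeb (F s t))).
Hypothesis minimality : forall s t N, U s t ->
  unit_normal_param F s t N -> mean_curvature F N s t = 0.

Definition unit_normal (s t : R) : C2 :=
  vadd (vscal (cos (beta s t)) (vscal Ci (e1 s t)))
       (vscal (RtoC (- sin (beta s t))) (vscal Ci (F s t))).

(* In the notation above, [cf1], [cf2] are the coordinates of [a], [b], [area] that of
   [a /\ b], [conn] those of [omega], and [sf1], [sf2] those of [h(., e1)], [h(., e2)]. *)
Definition cf1 (i : idx) (s t : R) : R := ip (pdV i F s t) (e1 s t).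
Definition cf2 (i : idx) (s t : R) : R := ip (pdV i F s t) (e2 s t).
Definition area (s t : R) : R := cf1 I1 s t * cf2 I2 s t - cf1 I2 s t * cf2 I1 s t.
Definition conn (i : idx) (s t : R) : R := ip (pdV i e1 s t) (e2 s t).
Definition sf1 (i : idx) (s t : R) : R := ip (pdV i e1 s t) (unit_normal s t).
Definition sf2 (i : idx) (s t : R) : R := ip (pdV i e2 s t) (unit_normal s t).

Lemma sin_cos_sq x : sin x * sin x + cos x * cos x = 1.
Proof. exact (sin2_cos2 x). Qed.

Lemma ip_e2 v s t : U s t ->
  ip v (e2 s t) = sin (beta s t) * ip v (vscal Ci (e1 s t)) + cos (beta s t) * ip v (vscal Ci (F s t)).
Proof.
intros H. rewrite angle by exact H. unfold Reeb. now rewrite ip_vadd_r, !ip_vscal_r.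
Qed.

Lemma ip_unit_normal v s t :
  ip v (unit_normal s t)
  = cos (beta s t) * ip v (vscal Ci (e1 s t)) - sin (beta s t) * ip v (vscal Ci (F s t)).
Proof. unfold unit_normal. rewrite ip_vadd_r, !ip_vscal_r. ring. Qed.

(** [e2] and [unit_normal] arise from i [e1] and i [F] by an orthogonal change of basis of their
    plane, which preserves the plane's contribution in [parseval_contact]. *)
Lemma parseval_frame v w s t : U s t ->
  ip v w = ip v (F s t) * ip w (F s t) + ip v (e1 s t) * ip w (e1 s t)
           + ip v (e2 s t) * ip w (e2 s t) + ip v (unit_normal s t) * ip w (unit_normal s t).
Proof.
intros H.
rewrite (parseval_contact (F s t) (e1 s t) v w) by auto.
rewrite !ip_e2, !ip_unit_normal by exact H.
assert (Hsc := sin_cos_sq (beta s t)).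
match goal with |- _ + (?p * ?q + ?r * ?m) = _ =>
  apply (f_equal (fun z => (z - 1) * (p * q + r * m))) in Hsc; cbv beta in Hsc end.
rewrite Rminus_diag, Rmult_0_l in Hsc. lra.
Qed.

Lemma ip_F_F s t : U s t -> ip (F s t) (F s t) = 1.
Proof. intros H. unfold ip. now rewrite (sphere s t H). Qed.

Lemma ip_F_e1 s t : U s t -> ip (F s t) (e1 s t) = 0.
Proof. intros H. apply (contact s t H). Qed.

Lemma ip_JF_e1 s t : U s t -> ip (vscal Ci (F s t)) (e1 s t) = 0.
Proof. intros H. apply (contact s t H). Qed.

Lemma ip_F_Je1 s t : U s t -> ip (F s t) (vscal Ci (e1 s t)) = 0.
Proof. intros H. assert (E := ip_JF_e1 s t H). rewrite ip_Ci_l in E. lra. Qed.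

Lemma ip_e1_JF s t : U s t -> ip (e1 s t) (vscal Ci (F s t)) = 0.
Proof. intros H. rewrite ip_sym. now apply ip_JF_e1. Qed.

Lemma ip_e1_e1 s t : U s t -> ip (e1 s t) (e1 s t) = 1.
Proof. apply unit_e1. Qed.

Lemma ip_e1_e2 s t : U s t -> ip (e1 s t) (e2 s t) = 0.
Proof. intros H. rewrite ip_e2, ip_Ci_diag, ip_e1_JF by exact H. ring. Qed.

Lemma ip_e1_normal s t : U s t -> ip (e1 s t) (unit_normal s t) = 0.
Proof. intros H. rewrite ip_unit_normal, ip_Ci_diag, ip_e1_JF by exact H. ring. Qed.

Lemma ip_F_normal s t : U s t -> ip (F s t) (unit_normal s t) = 0.
Proof. intros H. rewrite ip_unit_normal, ip_Ci_diag, ip_F_Je1 by exact H. ring. Qed.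

Lemma ip_e2_e2 s t : U s t -> ip (e2 s t) (e2 s t) = 1.
Proof.
intros H. rewrite ip_e2 by exact H. rewrite !(ip_sym (e2 s t)), !ip_e2 by exact H.
rewrite !ip_Ci_Ci, ip_F_F, ip_e1_e1, ip_F_e1, (ip_sym (e1 s t)), ip_F_e1 by exact H.
assert (Hsc := sin_cos_sq (beta s t)). lra.
Qed.

Lemma ip_e2_normal s t : U s t -> ip (e2 s t) (unit_normal s t) = 0.
Proof.
intros H. rewrite ip_unit_normal. rewrite !(ip_sym (e2 s t)), !ip_e2 by exact H.
rewrite !ip_Ci_Ci, ip_F_F, ip_e1_e1, ip_F_e1, (ip_sym (e1 s t)), ip_F_e1 by exact H. ring.
Qed.

Lemma ip_normal_normal s t : U s t -> ip (unit_normal s t) (unit_normal s t) = 1.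
Proof.
intros H. rewrite ip_unit_normal. rewrite !(ip_sym (unit_normal s t)), !ip_unit_normal.
rewrite !ip_Ci_Ci, ip_F_F, ip_e1_e1, ip_F_e1, (ip_sym (e1 s t)), ip_F_e1 by exact H.
assert (Hsc := sin_cos_sq (beta s t)). lra.
Qed.

(** * Structure equations of the moving frame *)

Lemma is_pdV_normal i s t : U s t ->
  is_pdV i unit_normal s t (pdV i unit_normal s t).
Proof.
intros H.
assert (Hb := smooth_is_pd U i _ s t Hbeta H).
assert (HN := is_pdV_vadd _ _ _ _ _ _ _
  (is_pdV_vscal _ _ _ _ _ _ _ (is_pd_cos _ _ _ _ _ Hb)
     (is_pdV_Ci _ _ _ _ _ (smooth_is_pdV U i _ s t He1 H)))
  (is_pdV_vscal _ _ _ _ _ _ _ (is_pd_opp _ _ _ _ _ (is_pd_sin _ _ _ _ _ Hb))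
     (is_pdV_Ci _ _ _ _ _ (smooth_is_pdV U i _ s t HF H)))).
rewrite (is_pdV_unique _ _ _ _ _ HN : pdV i unit_normal s t = _). exact HN.
Qed.

(** Source of the skew-symmetry relations below: each one differentiates a constant inner product of
    frame vectors. *)
Lemma pd_ip_const i (A B : R -> R -> C2) k s t V W :
  U s t -> (forall s t, U s t -> ip (A s t) (B s t) = k) ->
  is_pdV i A s t V -> is_pdV i B s t W -> ip V (B s t) + ip (A s t) W = 0.
Proof.
intros H HAB HA HB.
rewrite <- (is_pd_unique _ _ _ _ _ (is_pd_ip _ _ _ _ _ _ _ HA HB)).
apply is_pd_unique. eapply is_pd_ext_on; [exact HU | exact HAB | exact H | apply is_pd_const].
Qed.

Let dF i s t := smooth_is_pdV U i F s t HF.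
Let dE1 i s t := smooth_is_pdV U i e1 s t He1.
Let dE2 i s t := smooth_is_pdV U i e2 s t He2.
Let dN := is_pdV_normal.

Lemma ip_dF_F i s t : U s t -> ip (pdV i F s t) (F s t) = 0.
Proof.
intros H. assert (E := pd_ip_const i _ _ _ s t _ _ H ip_F_F (dF i s t H) (dF i s t H)).
rewrite (ip_sym (F s t)) in E. lra.
Qed.

Lemma ip_de1_F i s t : U s t -> ip (pdV i e1 s t) (F s t) = - cf1 i s t.
Proof.
intros H. assert (E := pd_ip_const i _ _ _ s t _ _ H ip_F_e1 (dF i s t H) (dE1 i s t H)).
rewrite (ip_sym (F s t)) in E. unfold cf1. lra.
Qed.

Lemma ip_de1_e1 i s t : U s t -> ip (pdV i e1 s t) (e1 s t) = 0.
Proof.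
intros H. assert (E := pd_ip_const i _ _ _ s t _ _ H ip_e1_e1 (dE1 i s t H) (dE1 i s t H)).
rewrite (ip_sym (e1 s t)) in E. lra.
Qed.

Lemma ip_de2_e1 i s t : U s t -> ip (pdV i e2 s t) (e1 s t) = - conn i s t.
Proof.
intros H. assert (E := pd_ip_const i _ _ _ s t _ _ H ip_e1_e2 (dE1 i s t H) (dE2 i s t H)).
rewrite (ip_sym (e1 s t)) in E. unfold conn. lra.
Qed.

Lemma ip_de2_e2 i s t : U s t -> ip (pdV i e2 s t) (e2 s t) = 0.
Proof.
intros H. assert (E := pd_ip_const i _ _ _ s t _ _ H ip_e2_e2 (dE2 i s t H) (dE2 i s t H)).
rewrite (ip_sym (e2 s t)) in E. lra.
Qed.

Lemma ip_dN_e1 i s t : U s t -> ip (pdV i unit_normal s t) (e1 s t) = - sf1 i s t.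
Proof.
intros H. assert (E := pd_ip_const i _ _ _ s t _ _ H ip_e1_normal (dE1 i s t H) (dN i s t H)).
rewrite (ip_sym (e1 s t)) in E. unfold sf1. lra.
Qed.

Lemma ip_dN_e2 i s t : U s t -> ip (pdV i unit_normal s t) (e2 s t) = - sf2 i s t.
Proof.
intros H. assert (E := pd_ip_const i _ _ _ s t _ _ H ip_e2_normal (dE2 i s t H) (dN i s t H)).
rewrite (ip_sym (e2 s t)) in E. unfold sf2. lra.
Qed.

Lemma ip_dN_normal i s t : U s t -> ip (pdV i unit_normal s t) (unit_normal s t) = 0.
Proof.
intros H. assert (E := pd_ip_const i _ _ _ s t _ _ H ip_normal_normal (dN i s t H) (dN i s t H)).
rewrite (ip_sym (unit_normal s t)) in E. lra.
Qed.

(** * Coframe, area and metric *)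

(** The coordinates of [e1], [e2] in the basis d_1, d_2 form an invertible matrix, so orthogonality
    to the normal passes from the frame to d_1 and d_2. *)
Lemma tangent_frame s t : U s t ->
  area s t <> 0 /\ forall i, ip (pdV i F s t) (unit_normal s t) = 0.
Proof.
intros H.
destruct (tangent_e1 s t H) as (a & b & Ha). destruct (tangent_e2 s t H) as (c & d & Hc).
assert (X1 := fun w => f_equal (fun z => ip z w) Ha).
assert (X2 := fun w => f_equal (fun z => ip z w) Hc).
cbv beta in X1, X2.
assert (X11 := X1 (e1 s t)). assert (X12 := X1 (e2 s t)).
assert (X21 := X2 (e1 s t)). assert (X22 := X2 (e2 s t)).
assert (X1N := X1 (unit_normal s t)). assert (X2N := X2 (unit_normal s t)).
rewrite ip_vadd_l, !ip_vscal_l in X11, X12, X21, X22, X1N, X2N.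
rewrite (ip_sym (e2 s t)) in X21.
rewrite ip_e1_e1 in X11 by exact H. rewrite ip_e1_e2 in X12, X21 by exact H.
rewrite ip_e2_e2 in X22 by exact H.
rewrite ip_e1_normal in X1N by exact H. rewrite ip_e2_normal in X2N by exact H.
(* The product of determinants is the determinant of the Gram matrix of ([e1], [e2]), the
   identity. *)
assert (Hdet : (a * d - b * c) * area s t = 1).
{ unfold area, cf1, cf2.
  transitivity ((a * ip (pdV I1 F s t) (e1 s t) + b * ip (pdV I2 F s t) (e1 s t)) *
     (c * ip (pdV I1 F s t) (e2 s t) + d * ip (pdV I2 F s t) (e2 s t)) -
     (a * ip (pdV I1 F s t) (e2 s t) + b * ip (pdV I2 F s t) (e2 s t)) *
     (c * ip (pdV I1 F s t) (e1 s t) + d * ip (pdV I2 F s t) (e1 s t))).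
  - ring.
  - rewrite <- X11, <- X12, <- X21, <- X22. ring. }
assert (Hcd : a * d - b * c <> 0) by (intros E; rewrite E in Hdet; lra).
split; [intros E; rewrite E in Hdet; lra | ].
intros i; apply (Rmult_eq_reg_l (a * d - b * c)); [ | exact Hcd].
destruct i.
- transitivity (d * (a * ip (pdV I1 F s t) (unit_normal s t) + b * ip (pdV I2 F s t) (unit_normal s t))
   - b * (c * ip (pdV I1 F s t) (unit_normal s t) + d * ip (pdV I2 F s t) (unit_normal s t)));
   [ring | rewrite <- X1N, <- X2N; ring].
- transitivity (a * (c * ip (pdV I1 F s t) (unit_normal s t) + d * ip (pdV I2 F s t) (unit_normal s t))
   - c * (a * ip (pdV I1 F s t) (unit_normal s t) + b * ip (pdV I2 F s t) (unit_normal s t)));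
   [ring | rewrite <- X1N, <- X2N; ring].
Qed.

Lemma area_neq_0 s t : U s t -> area s t <> 0.
Proof. intros H. apply (tangent_frame s t H). Qed.

Lemma ip_dF_normal i s t : U s t -> ip (pdV i F s t) (unit_normal s t) = 0.
Proof. intros H. apply (tangent_frame s t H). Qed.

Lemma ip_dF i w s t : U s t ->
  ip (pdV i F s t) w = cf1 i s t * ip w (e1 s t) + cf2 i s t * ip w (e2 s t).
Proof.
intros H. rewrite (parseval_frame _ _ s t H), ip_dF_F, ip_dF_normal by exact H.
unfold cf1, cf2. ring.
Qed.

Lemma metric_frame i j s t : U s t ->
  metric F i j s t = cf1 i s t * cf1 j s t + cf2 i s t * cf2 j s t.
Proof. intros H. unfold metric. now rewrite ip_dF. Qed.

Lemma det_metric_frame s t : U s t -> det_metric F s t = area s t ^ 2.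
Proof. intros H. unfold det_metric, area. rewrite !metric_frame by exact H. ring. Qed.

Lemma det_metric_neq_0 s t : U s t -> det_metric F s t <> 0.
Proof. intros H. rewrite det_metric_frame by exact H. now apply pow_nonzero, area_neq_0. Qed.

Lemma ip_dN_F i s t : U s t -> ip (pdV i unit_normal s t) (F s t) = 0.
Proof.
intros H. assert (E := pd_ip_const i _ _ _ s t _ _ H ip_F_normal (dF i s t H) (dN i s t H)).
rewrite ip_dF_normal, (ip_sym (F s t)) in E by exact H. lra.
Qed.

(** * Second fundamental form and minimality *)

(** Weingarten's relation, from differentiating <d_j F, N> = 0. *)
Lemma second_form_frame i j s t : U s t ->
  second_form F (unit_normal s t) i j s t = cf1 j s t * sf1 i s t + cf2 j s t * sf2 i s t.
Proof.
intros H. unfold second_form.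
assert (E := pd_ip_const i _ _ _ s t _ _ H (ip_dF_normal j)
  (smooth_is_pdV U i _ s t (smoothV_on_pdV _ j _ HF) H) (dN i s t H)).
rewrite ip_dF, ip_dN_e1, ip_dN_e2 in E by exact H. lra.
Qed.

Lemma second_form_sym s t : U s t ->
  cf1 I2 s t * sf1 I1 s t + cf2 I2 s t * sf2 I1 s t
  = cf1 I1 s t * sf1 I2 s t + cf2 I1 s t * sf2 I2 s t.
Proof.
intros H. rewrite <- !second_form_frame by exact H. unfold second_form.
now rewrite (pdV_comm U I1 I2).
Qed.

(** The left side is 2 [area] times the mean curvature, written as the coefficient of h(., e1) /\ b
    + a /\ h(., e2). *)
Lemma second_form_trace s t : U s t ->
  cf2 I2 s t * sf1 I1 s t - cf2 I1 s t * sf1 I2 s t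
  + cf1 I1 s t * sf2 I2 s t - cf1 I2 s t * sf2 I1 s t = 0.
Proof.
intros H.
assert (E : mean_curvature F (unit_normal s t) s t = 0).
{ apply minimality; [exact H | split; [ | split]].
  - now apply ip_F_normal.
  - now apply ip_normal_normal.
  - intros i. now apply ip_dF_normal. }
assert (HD := area_neq_0 s t H).
unfold mean_curvature, sum2, inv_metric in E.
rewrite !second_form_frame, !metric_frame, !det_metric_frame in E by exact H.
apply (Rmult_eq_reg_l (/ (2 * area s t))); [ | apply Rinv_neq_0_compat; lra].
rewrite Rmult_0_r. rewrite <- E. unfold area in *. field. exact HD.
Qed.

(* Matrix of the second fundamental form in the frame: [h11 = - H], [h12 = G], [h22 = H]. *)
Lemma second_form_coefficients s t : U s t ->
  exists G H : R, forall i,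
    sf1 i s t = - H * cf1 i s t + G * cf2 i s t /\
    sf2 i s t = G * cf1 i s t + H * cf2 i s t.
Proof.
intros Hst.
assert (HD := area_neq_0 s t Hst). assert (HS := second_form_sym s t Hst).
assert (HT := second_form_trace s t Hst).
(* Cramer's rule for [sf2] in the coframe. The trace and symmetry relations then determine [sf1]
   from the same two numbers. *)
exists ((sf2 I1 s t * cf2 I2 s t - sf2 I2 s t * cf2 I1 s t) / area s t),
  ((cf1 I1 s t * sf2 I2 s t - cf1 I2 s t * sf2 I1 s t) / area s t).
intros i. split.
- apply (Rmult_eq_reg_l (area s t)); [ | exact HD].
  match goal with |- _ = ?r => set (rhs := r) end.
  assert (E1 := f_equal (Rmult (cf1 i s t)) HT). assert (E2 := f_equal (Rmult (cf2 i s t)) HS).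
  transitivity (- (cf1 I1 s t * sf2 I2 s t - cf1 I2 s t * sf2 I1 s t) * cf1 i s t
    + (sf2 I1 s t * cf2 I2 s t - sf2 I2 s t * cf2 I1 s t) * cf2 i s t).
  + clear rhs. unfold area. destruct i; lra.
  + unfold rhs. field. exact HD.
- destruct i; unfold area in *; field; exact HD.
Qed.

(** * Derivatives of the contact angle *)

(** The terms of the derivative of [angle] that differentiate [beta] combine into [unit_normal],
    since cos(beta) i e1 - sin(beta) i F is N. The factor i is then moved onto [w]. *)
Lemma ip_de2 i w s t : U s t ->
  ip (pdV i e2 s t) w = pd i beta s t * ip (unit_normal s t) w
    - sin (beta s t) * ip (pdV i e1 s t) (vscal Ci w) - cos (beta s t) * ip (pdV i F s t) (vscal Ci w).
Proof.
intros H.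
assert (Hb := smooth_is_pd U i _ s t Hbeta H).
assert (HE : is_pdV i (fun s t => vadd (vscal (sin (beta s t)) (vscal Ci (e1 s t)))
       (vscal (cos (beta s t)) (vscal Ci (F s t)))) s t (pdV i e2 s t)).
{ destruct (dE2 i s t H) as (D1 & D2 & D3 & D4).
  repeat split; (eapply is_pd_ext_on; [exact HU | | exact H | eassumption]);
    intros s' t' H'; cbv beta; now rewrite (angle s' t' H'). }
assert (HN := is_pdV_vadd _ _ _ _ _ _ _
  (is_pdV_vscal _ _ _ _ _ _ _ (is_pd_sin _ _ _ _ _ Hb)
     (is_pdV_Ci _ _ _ _ _ (dE1 i s t H)))
  (is_pdV_vscal _ _ _ _ _ _ _ (is_pd_cos _ _ _ _ _ Hb)
     (is_pdV_Ci _ _ _ _ _ (dF i s t H)))).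
rewrite <- (is_pdV_unique _ _ _ _ _ HE), (is_pdV_unique _ _ _ _ _ HN).
unfold unit_normal. rewrite !ip_vadd_l, !ip_vscal_l, !ip_Ci_l. ring.
Qed.

(** Normal component of the derivative of [e2], where i N = - cos(beta) e1 + sin(beta) F. *)
Lemma pd_beta i s t : U s t -> pd i beta s t = sf2 i s t - cf1 i s t.
Proof.
intros H. unfold sf2. rewrite ip_de2, ip_normal_normal by exact H.
assert (EJ : forall v, ip v (vscal Ci (unit_normal s t))
   = - cos (beta s t) * ip v (e1 s t) + sin (beta s t) * ip v (F s t)).
{ intros v. assert (X := ip_Ci_l v (unit_normal s t)). rewrite ip_unit_normal, !ip_Ci_Ci in X. lra. }
rewrite !EJ, ip_de1_e1, ip_de1_F, ip_dF_F by exact H.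
fold (cf1 i s t).
assert (E := f_equal (Rmult (cf1 i s t)) (sin_cos_sq (beta s t))). lra.
Qed.

(** Component of the derivative of [e2] along [e1], where i e1 = sin(beta) e2 + cos(beta) N. The
    term sin(beta)^2 omega moved to the left leaves cos(beta)^2 omega, hence the common factor
    cos(beta). *)
Lemma conn_contact i s t : U s t ->
  cos (beta s t) * (cos (beta s t) * conn i s t)
  = cos (beta s t) * (sin (beta s t) * (sf1 i s t + cf2 i s t)).
Proof.
intros H.
assert (E := ip_de2 i (e1 s t) s t H).
rewrite ip_de2_e1, (ip_sym (unit_normal s t)), ip_e1_normal in E by exact H.
assert (EJ : forall v, ip v (vscal Ci (e1 s t))
   = sin (beta s t) * ip v (e2 s t) + cos (beta s t) * ip v (unit_normal s t)).
{ intros v. rewrite ip_e2, ip_unit_normal by exact H.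
  assert (X := f_equal (Rmult (ip v (vscal Ci (e1 s t)))) (sin_cos_sq (beta s t))). lra. }
rewrite !EJ, ip_dF_normal in E by exact H.
fold (conn i s t) (sf1 i s t) (cf2 i s t) in E.
assert (X := f_equal (Rmult (conn i s t)) (sin_cos_sq (beta s t))). lra.
Qed.

(** The numerators are, up to sign, the coefficients of the Hodge dual of d beta, equal to h(., e1)
    - b by minimality. This is the form required by [divergence_density]. *)
Lemma grad_beta s t : U s t ->
  grad_coord F beta I1 s t = (sf1 I2 s t - cf2 I2 s t) / area s t /\
  grad_coord F beta I2 s t = - (sf1 I1 s t - cf2 I1 s t) / area s t.
Proof.
intros H. destruct (second_form_coefficients s t H) as (G & K & HGK).
assert (HD := area_neq_0 s t H).
unfold grad_coord, sum2, inv_metric.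
rewrite !pd_beta, !metric_frame, !det_metric_frame by exact H.
rewrite !(proj1 (HGK _)), !(proj2 (HGK _)).
unfold area in *. split; field; exact HD.
Qed.

(** * Gauss curvature *)

Lemma christoffel_frame j k s t : U s t ->
  sum2 (fun i => christoffel F i j k s t * cf1 i s t) = ip (pdV j (pdV k F) s t) (e1 s t) /\
  sum2 (fun i => christoffel F i j k s t * cf2 i s t) = ip (pdV j (pdV k F) s t) (e2 s t).
Proof.
intros H. assert (HD := area_neq_0 s t H).
assert (L := fun l => christoffel_lower U F HU HF j k l s t H (det_metric_neq_0 s t H)).
assert (L1 := L I1). assert (L2 := L I2). unfold sum2 in *.
rewrite (ip_sym _ (pdV I1 F s t)), ip_dF, !metric_frame in L1 by exact H.
rewrite (ip_sym _ (pdV I2 F s t)), ip_dF, !metric_frame in L2 by exact H.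
set (x := ip _ (e1 s t)) in *. set (y := ip _ (e2 s t)) in *.
(* [L1] and [L2] form a linear system of determinant [area], solved by Cramer's rule. *)
split; apply (Rmult_eq_reg_l (area s t)); try exact HD; unfold area.
- apply (f_equal (Rmult (cf2 I2 s t))) in L1. apply (f_equal (Rmult (cf2 I1 s t))) in L2. lra.
- apply (f_equal (Rmult (cf1 I2 s t))) in L1. apply (f_equal (Rmult (cf1 I1 s t))) in L2. lra.
Qed.

(** The second fundamental form of the sphere along the position vector, responsible for the 1 in
    the curvature formula. *)
Lemma ip_ddF_F i j s t : U s t -> ip (pdV i (pdV j F) s t) (F s t) = - metric F i j s t.
Proof.
intros H.
assert (E := pd_ip_const i _ _ _ s t _ _ H (ip_dF_F j)
  (smooth_is_pdV U i _ s t (smoothV_on_pdV _ j _ HF) H) (dF i s t H)).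
rewrite (ip_sym (pdV j F s t)) in E. unfold metric. lra.
Qed.

(** In the frame, the tangential parts of [gauss_equation] cancel against the Christoffel terms. The
    position part contributes 1 and the normal part det h = - (G^2 + H^2). *)
Lemma gauss_curvature_second_form s t G H : U s t ->
  (forall i, sf1 i s t = - H * cf1 i s t + G * cf2 i s t /\
             sf2 i s t = G * cf1 i s t + H * cf2 i s t) ->
  gauss_curvature F s t = 1 - (G * G + H * H).
Proof.
intros Hst HGH. assert (HD := area_neq_0 s t Hst).
unfold gauss_curvature.
rewrite (gauss_equation U F HU HF s t Hst det_metric_neq_0).
rewrite !(parseval_frame (pdV _ (pdV _ F) s t) (pdV _ (pdV _ F) s t) s t Hst).
rewrite !ip_ddF_F by exact Hst.
assert (Hh := fun i j => second_form_frame i j s t Hst). unfold second_form in Hh.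
rewrite !Hh.
destruct (christoffel_frame I2 I2 s t Hst) as [C221 C222].
destruct (christoffel_frame I1 I2 s t Hst) as [C121 C122].
rewrite <- C221, <- C222, <- C121, <- C122.
unfold sum2. rewrite !(ip_dF _ _ s t Hst), <- C121, <- C122.
rewrite !metric_frame, det_metric_frame by exact Hst.
rewrite !(proj1 (HGH _)), !(proj2 (HGH _)).
unfold sum2, area in *. field. exact HD.
Qed.

(** * Laplacian of the contact angle *)

(** The exterior derivative of h(., e1) - b is omega /\ (h(., e2) + a), and the Laplacian is its
    coefficient divided by [area]. *)
Lemma laplacian_beta s t : U s t ->
  laplacian F beta s t
  = (conn I1 s t * (sf2 I2 s t + cf1 I2 s t) - conn I2 s t * (sf2 I1 s t + cf1 I1 s t)) / area s t.
Proof.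
intros H.
assert (dsf1 : forall i j, is_pd i (sf1 j) s t
  (ip (pdV i (pdV j e1) s t) (unit_normal s t) + ip (pdV j e1 s t) (pdV i unit_normal s t))).
{ intros i j. apply is_pd_ip; [ | now apply dN].
  apply (smooth_is_pdV U); auto using smoothV_on_pdV. }
assert (dcf2 : forall i j, is_pd i (cf2 j) s t
  (ip (pdV i (pdV j F) s t) (e2 s t) + ip (pdV j F s t) (pdV i e2 s t))).
{ intros i j. apply is_pd_ip; [ | now apply dE2].
  apply (smooth_is_pdV U); auto using smoothV_on_pdV. }
assert (dcf1 : forall i j, is_pd i (cf1 j) s t
  (ip (pdV i (pdV j F) s t) (e1 s t) + ip (pdV j F s t) (pdV i e1 s t))).
{ intros i j. apply is_pd_ip; [ | now apply dE1].
  apply (smooth_is_pdV U); auto using smoothV_on_pdV. }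
assert (darea := fun i => is_pd_minus _ _ _ _ _ _ _
  (is_pd_mult _ _ _ _ _ _ _ (dcf1 i I1) (dcf2 i I2))
  (is_pd_mult _ _ _ _ _ _ _ (dcf1 i I2) (dcf2 i I1))).
unfold laplacian.
rewrite (divergence_density U F (grad_coord F beta)
  (fun i s t => match i with I1 => sf1 I2 s t - cf2 I2 s t | I2 => - (sf1 I1 s t - cf2 I1 s t) end)
  area s t _ _ _ _ HU HF H det_metric_frame
  ltac:(intros [ | ] s' t' H'; apply (grad_beta s' t' H'))
  (area_neq_0 s t H) (darea I1) (darea I2)
  (is_pd_minus _ _ _ _ _ _ _ (dsf1 I1 I2) (dcf2 I1 I2))
  (is_pd_opp _ _ _ _ _ (is_pd_minus _ _ _ _ _ _ _ (dsf1 I2 I1) (dcf2 I2 I1)))).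
f_equal.
(* Commuting derivatives cancels the second-order terms; the remaining products of first derivatives
   expand in the frame. *)
rewrite (pdV_comm U I2 I1 e1), (pdV_comm U I2 I1 F) by assumption.
rewrite !(parseval_frame (pdV _ e1 s t) (pdV _ unit_normal s t) s t H).
rewrite !(ip_dF _ _ s t H).
rewrite !ip_dN_F, !ip_de1_e1, !ip_dN_e1, !ip_dN_e2, !ip_dN_normal, !ip_de2_e1, !ip_de2_e2 by exact H.
fold (conn I1 s t) (conn I2 s t). ring.
Qed.

(** Dividing by cos(beta) gives omega = tan(beta) (- H a + (G + 1) b), to be wedged with h(., e2) +
    a = (G + 1) a + H b. *)
Lemma laplacian_beta_second_form s t G H : U s t -> cos (beta s t) <> 0 ->
  (forall i, sf1 i s t = - H * cf1 i s t + G * cf2 i s t /\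
             sf2 i s t = G * cf1 i s t + H * cf2 i s t) ->
  laplacian F beta s t = - tan (beta s t) * ((G + 1) * (G + 1) + H * H).
Proof.
intros Hst Hcos HGH. assert (HD := area_neq_0 s t Hst).
assert (Hc : forall i, conn i s t = tan (beta s t) * (sf1 i s t + cf2 i s t)).
{ intros i. assert (E := conn_contact i s t Hst).
  apply Rmult_eq_reg_l in E; [ | exact Hcos].
  apply (Rmult_eq_reg_l (cos (beta s t))); [ | exact Hcos].
  rewrite E. unfold tan. field. exact Hcos. }
rewrite laplacian_beta, !Hc, !(proj1 (HGH _)), !(proj2 (HGH _)) by exact Hst.
unfold area in *. field. exact HD.
Qed.

(** Here grad beta = (G - 1) e1 + H e2. The parameter [r] covers both norms in the theorem, with
    values 1 and 2. *)
Lemma normsq_grad_beta s t G H r : U s t ->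
  (forall i, sf1 i s t = - H * cf1 i s t + G * cf2 i s t /\
             sf2 i s t = G * cf1 i s t + H * cf2 i s t) ->
  normsq (vadd (gradient F beta s t) (vscal (RtoC r) (e1 s t)))
  = (G - 1 + r) * (G - 1 + r) + H * H.
Proof.
intros Hst HGH. assert (HD := area_neq_0 s t Hst).
unfold normsq. rewrite (parseval_frame _ _ s t Hst).
unfold gradient. rewrite !ip_vadd_l, !ip_vscal_l.
rewrite !ip_dF_F, !ip_dF_normal, ip_e1_e1, ip_e1_e2, ip_e1_normal, (ip_sym (e1 s t) (F s t)), ip_F_e1
  by exact Hst.
destruct (grad_beta s t Hst) as [-> ->].
fold (cf1 I1 s t) (cf1 I2 s t) (cf2 I1 s t) (cf2 I2 s t).
rewrite !(proj1 (HGH _)).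
unfold area in *. field. exact HD.
Qed.

Lemma vscal_1 z : vscal (RtoC 1) z = z.
Proof. rewrite vscal_re. apply C2_eq; apply Rmult_1_l. Qed.

Lemma contact_angle_equations s t : U s t -> cos (beta s t) <> 0 ->
  gauss_curvature F s t = 1 - normsq (vadd (gradient F beta s t) (e1 s t)) /\
  laplacian F beta s t
  = - tan (beta s t) * normsq (vadd (gradient F beta s t) (vscal (RtoC 2) (e1 s t))).
Proof.
intros Hst Hcos. destruct (second_form_coefficients s t Hst) as (G & H & HGH).
rewrite <- (vscal_1 (e1 s t)) at 1.
rewrite !(normsq_grad_beta s t G H _ Hst HGH).
rewrite (gauss_curvature_second_form s t G H Hst HGH).
rewrite (laplacian_beta_second_form s t G H Hst Hcos HGH).
split; ring.
Qed.

End AdaptedFrame.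

Theorem mainTheorem4 (S : Type) (A : chart S -> Prop) (X : S -> C2)
    (hS : immersed_orientable_surface A X)
    (hmin : minimal A X)
    (W : S -> Prop) (e1 e2 : S -> C2) (beta : S -> R)
    (hframe : contact_angle_frame A X W e1 e2 beta)
    (p : S) (hp : W p) (hcos : cos (beta p) <> 0)
    (c : chart S) (hc : A c) (hcp : in_chart c p) :
  K_at X c p = 1 - normsq (vadd (grad_at X beta c p) (e1 p)) /\
  Laplacian_at X beta c p =
    - tan (beta p) * normsq (vadd (grad_at X beta c p) (vscal 2 (e1 p))).
Proof.
(* All quantities are local: the frame equations are applied to the part of the chart domain lying
   over [W]. *)
set (U := fun u v => dom c u v /\ W (par c u v)).
destruct (ios_atlas _ _ hS) as [Hval _]. destruct (Hval c hc) as [_ Hcoord].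
destruct hframe as [Hopen Hs1 Hs2 Hsb Ht1 Ht2 Hcon Hu1 _ _ Hang].
assert (HF : smoothV_on U (in_coords c X)).
{ destruct (ios_smooth _ _ hS c hc) as (D1 & D2 & D3 & D4).
  repeat split; intros n u v Huv; [apply D1 | apply D2 | apply D3 | apply D4]; split; try exact I; apply Huv. }
assert (Hin : forall u v, U u v -> in_chart c (par c u v)).
{ intros u v [Hd _]. destruct (Hcoord u v Hd) as [E1 E2]. split; rewrite E1, E2; [exact Hd | reflexivity]. }
(* On [U], [coord] inverts [par], which turns hypotheses at points of the surface into hypotheses on
   coordinates. *)
assert (Hat : forall u v (T : Type) (Q : R -> R -> T), U u v -> at_point c (par c u v) Q = Q u v).
{ intros u v T Q [Hd _]. unfold at_point. destruct (Hcoord u v Hd) as [-> ->]. reflexivity. }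
assert (Htan : forall e, (forall q, W q -> tangent A X q (e q)) ->
  forall u v, U u v -> tangent_param (in_coords c X) u v (in_coords c e u v)).
{ intros e He u v Huv. assert (E := He _ (proj2 Huv) c hc (Hin u v Huv)). now rewrite Hat in E. }
assert (Hmean : forall u v N, U u v -> unit_normal_param (in_coords c X) u v N ->
  mean_curvature (in_coords c X) N u v = 0).
{ intros u v N Huv HN. rewrite <- (hmin c (par c u v) N hc (Hin u v Huv)).
  - now rewrite Hat.
  - now rewrite Hat. }
destruct hcp as [Hdom Hpar].
set (u := coord c I1 p) in *. set (v := coord c I2 p) in *.
assert (Huv : U u v) by (split; [exact Hdom | now rewrite Hpar]).
assert (HU : open2 U) by exact (Hopen c hc).
assert (Hloc := contact_angle_equations U (in_coords c X) (in_coords c e1) (in_coords c e2)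
  (in_coords c beta) HU HF (Hs1 c hc) (Hs2 c hc) (Hsb c hc)
  (fun s t _ => ios_sphere _ _ hS (par c s t))
  (fun s t Hst => Hcon _ (proj2 Hst)) (fun s t Hst => Hu1 _ (proj2 Hst))
  (Htan e1 Ht1) (Htan e2 Ht2) (fun s t Hst => Hang _ (proj2 Hst)) Hmean u v Huv).
assert (Ep : forall T (f : S -> T), in_coords c f u v = f p)
  by (intros; unfold in_coords; now rewrite Hpar).
rewrite !Ep in Hloc. exact (Hloc hcos).
Qed.
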